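(* Let $T$ be a quaternion tensor of size $2\times3\times3$ (three frontal slices, each a $2\times3$ quaternion matrix) or of size $3\times3\times2$ (three frontal slices, each a $3\times2$ quaternion matrix). Then $\mathrm{rank}(T)\le4$.
   Context: $\mathbb{H}$ denotes the real quaternions. An $n_1\times n_2\times n_3$ quaternion tensor is an array $T=(T_{ijk})$ with entries in $\mathbb{H}$, $1\le i\le n_1$, $1\le j\le n_2$, $1\le k\le n_3$; it is written $T=(A_1;\dots;A_{n_2})$ where the frontal slice $A_j$ is the $n_1\times n_3$ matrix $(T_{ijk})_{i,k}$. A nonzero tensor is simple if $T_{ijk}=a_ib_jc_k$ (quaternion product in this order) for some $\vec a\in\mathbb{H}^{n_1},\vec b\in\mathbb{H}^{n_2},\vec c\in\mathbb{H}^{n_3}$. The rank of $T$ is the least number of simple tensors summing to $T$ (the zero tensor has rank $0$). *)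

(* Defs.v *)
From mathcomp Require Import all_boot all_order all_algebra.
From mathcomp Require Import reals.
Set Implicit Arguments. Unset Strict Implicit. Unset Printing Implicit Defensive.
Import Order.TTheory GRing.Theory Num.Theory.
Local Open Scope ring_scope.

Record quat (R : realType) := Quat { q0 : R; q1 : R; q2 : R; q3 : R }.

Definition qzero (R : realType) : quat R := Quat 0 0 0 0.

Definition qadd (R : realType) (x y : quat R) : quat R :=
  Quat (q0 x + q0 y) (q1 x + q1 y) (q2 x + q2 y) (q3 x + q3 y).

(* Hamilton product: i^2 = j^2 = k^2 = ijk = -1. *)
Definition qmul (R : realType) (x y : quat R) : quat R :=
  Quat (q0 x * q0 y - q1 x * q1 y - q2 x * q2 y - q3 x * q3 y)
       (q0 x * q1 y + q1 x * q0 y + q2 x * q3 y - q3 x * q2 y)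
       (q0 x * q2 y - q1 x * q3 y + q2 x * q0 y + q3 x * q1 y)
       (q0 x * q3 y + q1 x * q2 y - q2 x * q1 y + q3 x * q0 y).

(* An n1 x n2 x n3 quaternion tensor T = (T_ijk); the frontal slice A_j is
   the n1 x n3 matrix (T i j k)_{i,k}. *)
Definition qtensor (R : realType) (n1 n2 n3 : nat) :=
  'I_n1 -> 'I_n2 -> 'I_n3 -> quat R.

Definition is_simple (R : realType) (n1 n2 n3 : nat) (T : qtensor R n1 n2 n3) : Prop :=
  (exists i j k, T i j k <> qzero R) /\
  exists (a : 'I_n1 -> quat R) (b : 'I_n2 -> quat R) (c : 'I_n3 -> quat R),
    forall i j k, T i j k = qmul (qmul (a i) (b j)) (c k).

(* rank T <= r : T is a sum of s <= r simple tensors (empty sum = zero tensor). *)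
Definition rank_le (R : realType) (n1 n2 n3 : nat) (T : qtensor R n1 n2 n3) (r : nat) : Prop :=
  exists s : nat, (s <= r)%N /\
  exists S : 'I_s -> qtensor R n1 n2 n3,
    (forall l, is_simple (S l)) /\
    forall i j k, T i j k = \big[@qadd R/qzero R]_(l < s) S l i j k.

(* Main.v *)
From HB Require Import structures.
Require Import Defs.
From mathcomp Require Import all_boot all_order all_algebra.
From mathcomp Require Import reals.
From mathcomp Require Import fingroup perm ring lra.
From Stdlib Require Ncring Ncring_tac.
Set Implicit Arguments. Unset Strict Implicit. Unset Printing Implicit Defensive.
Import Order.TTheory GRing.Theory Num.Theory.
Local Open Scope ring_scope.

(** A 2 x 3 x 3 tensor is a pair of 3 x 3 matrices X = (T_1jk), Y = (T_2jk), and a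
    simple term contributes (a_1 b c, a_2 b c) with b a column and c a row.

    If X + zY is invertible for some scalar z, a change of the index k and of the
    index i reduces to X = 1.  If Y is diagonal, three terms suffice.  Otherwise
    permute j and k simultaneously so that the lower left entry of Y is nonzero: then
    one rank one matrix agrees with Y below the diagonal, and it can be chosen so that
    the difference is upper triangular with prescribed distinct diagonal entries.
    Such a matrix has three independent left eigenvectors, hence three more terms.

    If X and Y have rank at most one, two terms suffice.  Otherwise, say, X = diag(1, 1, 0)
    up to equivalence over the division ring, and an elimination shows that
    either X + zY is invertible for some z in {1, 2, 3}, or X and Y have a common kernel
    vector, or their images lie in a common plane, or some plane is mapped
    by both into a common line.  In the last three cases X and Y are both
    sums of two products b c in each of which b or c is common to X and Y, and each
    such product costs two terms.

    Conjugate transposition exchanges the formats 2 x 3 x 3 and 3 x 3 x 2. *)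

(** * Normalisation of identities in noncommutative rings *)

Section NoncommutativeRing.
Variable D : nzRingType.

#[local] Instance nc_ring_ops :
  @Ncring.Ring_ops D 0 1 +%R *%R (fun x y => x - y) -%R eq := {}.

Lemma nc_ring_laws : Ncring.Ring (Ro := nc_ring_ops).
Proof.
split; try exact _.
- exact: add0r.
- exact: addrC.
- exact: addrA.
- exact: mul1r.
- exact: mulr1.
- exact: mulrA.
- exact: mulrDl.
- by move=> x y z; apply: mulrDr.
- by [].
- exact: subrr.
Qed.
End NoncommutativeRing.

#[local] Existing Instance nc_ring_ops.
#[local] Existing Instance nc_ring_laws.
Local Ltac nc_ring := Ncring_tac.non_commutative_ring.

(** * Pairs of matrices as sums of simple terms *)

Section Pencils.
Variable D : unitRingType.

(** The coefficients stand on the left, as [a_i] does in [a_i b_j c_k]. Terms may vanish; they are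
    discarded only on the way back to tensors. *)
Definition pencil_rank_le m n (X Y : 'M[D]_(m, n)) r :=
  exists s : seq (D * D * 'cV[D]_m * 'rV[D]_n),
  [/\ (size s <= r)%N,
      X = \sum_(u <- s) u.1.1.1 *: (u.1.2 *m u.2) &
      Y = \sum_(u <- s) u.1.1.2 *: (u.1.2 *m u.2)].

Lemma pencil_rank_leW m n (X Y : 'M[D]_(m, n)) r r' :
  (r <= r')%N -> pencil_rank_le X Y r -> pencil_rank_le X Y r'.
Proof. by move=> rr' [s [sr -> ->]]; exists s; rewrite (leq_trans sr). Qed.

Lemma pencil_rank_leD m n (X Y X' Y' : 'M[D]_(m, n)) r r' :
  pencil_rank_le X Y r -> pencil_rank_le X' Y' r' ->
  pencil_rank_le (X + X') (Y + Y') (r + r').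
Proof.
move=> [s [sr -> ->]] [s' [sr' -> ->]]; exists (s ++ s').
by rewrite size_cat leq_add // !big_cat.
Qed.

Lemma pencil_rank_le_term m n (a1 a2 : D) (b : 'cV[D]_m) (c : 'rV[D]_n) :
  pencil_rank_le (a1 *: (b *m c)) (a2 *: (b *m c)) 1.
Proof. by exists [:: (a1, a2, b, c)]; rewrite !big_seq1. Qed.

Lemma pencil_rank_leC m n (X Y : 'M[D]_(m, n)) r :
  pencil_rank_le X Y r -> pencil_rank_le Y X r.
Proof.
move=> [s [sr -> ->]]; exists [seq (u.1.1.2, u.1.1.1, u.1.2, u.2) | u <- s].
by rewrite size_map !big_map.
Qed.

(** The factor [G] is absorbed by the row of each term. A factor on the left would have to cross the
    coefficients, with which its entries need not commute. *)
Lemma pencil_rank_le_mulmxr m n p (X Y : 'M[D]_(m, n)) (G : 'M_(n, p)) r :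
  pencil_rank_le X Y r -> pencil_rank_le (X *m G) (Y *m G) r.
Proof.
move=> [s [sr -> ->]]; exists [seq (u.1.1.1, u.1.1.2, u.1.2, u.2 *m G) | u <- s].
rewrite size_map !big_map !mulmx_suml; split=> //;
  by apply: eq_bigr => u _; rewrite -scalemxAl mulmxA.
Qed.

Lemma pencil_rank_le_shift m n (X Y : 'M[D]_(m, n)) (z : D) r :
  pencil_rank_le (X + z *: Y) Y r -> pencil_rank_le X Y r.
Proof.
move=> [s [sr EX EY]].
exists [seq (u.1.1.1 - z * u.1.1.2, u.1.1.2, u.1.2, u.2) | u <- s].
rewrite size_map !big_map; split=> //=.
under eq_bigr do rewrite scalerBl -scalerA.
by rewrite sumrB -scaler_sumr -EX -EY addrK.
Qed.

Lemma pencil_rank_le_perm n (s : 'S_n) (X Y : 'M[D]_n) r :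
  pencil_rank_le (row_perm s (col_perm s X)) (row_perm s (col_perm s Y)) r ->
  pencil_rank_le X Y r.
Proof.
move=> [l [lr EX EY]].
exists [seq (u.1.1.1, u.1.1.2, row_perm s^-1 u.1.2, col_perm s^-1 u.2) | u <- l].
rewrite size_map !big_map; split=> //=.
  apply/matrixP => i j; have /matrixP/(_ (s^-1 i)%g (s^-1 j)%g) := EX.
  rewrite !mxE !permKV => ->; rewrite !summxE; apply: eq_bigr => u _.
  by rewrite !mxE; congr (_ * _); apply: eq_bigr => k _; rewrite !mxE.
apply/matrixP => i j; have /matrixP/(_ (s^-1 i)%g (s^-1 j)%g) := EY.
rewrite !mxE !permKV => ->; rewrite !summxE; apply: eq_bigr => u _.
by rewrite !mxE; congr (_ * _); apply: eq_bigr => k _; rewrite !mxE.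
Qed.

Lemma pencil_rank_le_col m n (x y : 'cV[D]_m) (e : 'rV[D]_n) :
  pencil_rank_le (x *m e) (y *m e) 2.
Proof.
exists [:: (1, 0, x, e); (0, 1, y, e)].
by rewrite !big_cons !big_nil /= !scale1r !scale0r !addr0 add0r.
Qed.

Lemma pencil_rank_le_row m n (b : 'cV[D]_m) (x y : 'rV[D]_n) :
  pencil_rank_le (b *m x) (b *m y) 2.
Proof.
exists [:: (1, 0, b, x); (0, 1, b, y)].
by rewrite !big_cons !big_nil /= !scale1r !scale0r !addr0 add0r.
Qed.

(** * Invertible matrices and the rank normal form over a division ring *)

Definition invertible_mx n (A : 'M[D]_n) :=
  exists B, A *m B = 1%:M /\ B *m A = 1%:M.

Lemma invertible_mx1 n : invertible_mx (1%:M : 'M_n).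
Proof. by exists 1%:M; rewrite mulmx1. Qed.

Lemma invertible_mxM n (A B : 'M_n) :
  invertible_mx A -> invertible_mx B -> invertible_mx (A *m B).
Proof.
move=> [A' [AA' A'A]] [B' [BB' B'B]]; exists (B' *m A').
by rewrite -!mulmxA (mulmxA B) BB' mul1mx AA' (mulmxA A') A'A mul1mx B'B.
Qed.

Lemma invertible_tperm_mx n (i j : 'I_n) : invertible_mx (tperm_mx i j).
Proof. by exists (tperm_mx i j); rewrite -perm_mxM tperm2 perm_mx1. Qed.

Lemma invertible_diag_block n (A : 'M_n) :
  invertible_mx A -> invertible_mx (block_mx (1%:M : 'M_1) 0 0 A).
Proof.
move=> [A' [AA' A'A]]; exists (block_mx 1%:M 0 0 A').
by rewrite !mulmx_block !(mulmx0, mul0mx, mulmx1, addr0, add0r) AA' A'A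
           -scalar_mx_block.
Qed.

Hypothesis divD : forall x : D, x != 0 -> x \is a GRing.unit.

Lemma invertible_pivot n (a : D) (c : 'cV_n) :
  a != 0 -> invertible_mx (block_mx (a%:M : 'M_1) 0 c 1%:M).
Proof.
move=> /divD ua; exists (block_mx a^-1%:M 0 (- c *m a^-1%:M) 1%:M).
rewrite !mulmx_block !(mulmx0, mul0mx, mulmx1, mul1mx, addr0, add0r).
rewrite -!scalar_mxM mulrV // mulVr // mulNmx subrr.
by rewrite -mulNmx -mulmxA -scalar_mxM mulVr // mulmx1 addNr -scalar_mx_block.
Qed.

Lemma invertible_upper n (r : 'rV[D]_n) :
  invertible_mx (block_mx (1%:M : 'M_1) r 0 1%:M).
Proof.
exists (block_mx 1%:M (- r) 0 1%:M).
by rewrite !mulmx_block !(mulmx0, mul0mx, mulmx1, mul1mx, addr0, add0r)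
  ?addNr ?subrr -scalar_mx_block.
Qed.

(** Gaussian elimination: a nonzero entry is moved to the upper left corner, its row and column are
    cleared, and induction applies to the Schur complement [S]. *)
Lemma rank_normal_form n (X : 'M[D]_n) :
  exists G H r, [/\ invertible_mx G, invertible_mx H & X = G *m pid_mx r *m H].
Proof.
elim: n X => [|n IH] X.
  exists 1%:M, 1%:M, 0%N; split; try exact: invertible_mx1.
  by apply/matrixP => -[].
case: (pickP (fun u : 'I_n.+1 * 'I_n.+1 => X u.1 u.2 != 0)) => [[i j] /= Xij|X0];
  last first.
  exists 1%:M, 1%:M, 0%N; split; try exact: invertible_mx1.
  rewrite pid_mx_0 mulmx0 mul0mx; apply/matrixP => i j; rewrite mxE.
  by apply/eqP; have /negbFE := X0 (i, j).
pose P := @tperm_mx D n.+1 i 0; pose Q := @tperm_mx D n.+1 j 0.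
pose Z : 'M_(1 + n) := xrow i 0 (xcol j 0 X).
have Z00 : Z 0 0 != 0 by rewrite /Z !mxE !tpermR.
have XZ : X = P *m Z *m Q.
  have t2 k : @tperm_mx D n.+1 k 0 *m tperm_mx k 0 = 1%:M.
    by rewrite -perm_mxM tperm2 perm_mx1.
  rewrite /Z xrowE xcolE !mulmxA t2 mul1mx.
  by rewrite -mulmxA t2 mulmx1.
move: {Xij} Z Z00 XZ => Z Z00 XZ.
pose a := Z 0 0; pose S := drsubmx Z - dlsubmx Z *m a^-1%:M *m ursubmx Z.
have ua := divD Z00.
have ulZ : ulsubmx Z = a%:M.
  by apply/matrixP => u v; rewrite !ord1 !mxE !lshift0.
have ZE : Z = block_mx a%:M 0 (dlsubmx Z) 1%:M *m block_mx 1%:M 0 0 S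
               *m block_mx 1%:M (a^-1%:M *m ursubmx Z) 0 1%:M.
  rewrite !mulmx_block !(mulmx0, mul0mx, mulmx1, mul1mx, addr0, add0r).
  by rewrite !mulmxA -scalar_mxM mulrV // mul1mx addrC subrK -ulZ submxK.
have [G [H [r [iG iH SE]]]] := IH S.
have SE' : block_mx 1%:M 0 0 S = block_mx (1%:M : 'M_1) 0 0 G *m
             pid_mx r.+1 *m block_mx 1%:M 0 0 H.
  have -> : pid_mx r.+1 = block_mx (1%:M : 'M_1) 0 0 (pid_mx r) :> 'M[D]_(1 + n).
    rewrite -[LHS]submxK; congr block_mx; apply/matrixP => u v;
      by rewrite ?ord1 !mxE //= ?ord1.
  by rewrite !mulmx_block !(mulmx0, mul0mx, mulmx1, mul1mx, addr0, add0r) SE.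
rewrite XZ ZE SE'.
exists (P *m (block_mx a%:M 0 (dlsubmx Z) 1%:M *m block_mx 1%:M 0 0 G)).
exists (block_mx 1%:M 0 0 H *m block_mx 1%:M (a^-1%:M *m ursubmx Z) 0 1%:M *m Q).
exists r.+1; split; last by rewrite !mulmxA.
  apply: invertible_mxM; first exact: invertible_tperm_mx.
  apply: invertible_mxM; first exact: invertible_pivot.
  exact: invertible_diag_block.
apply: invertible_mxM; last exact: invertible_tperm_mx.
apply: invertible_mxM; first exact: invertible_diag_block.
exact: invertible_upper.
Qed.

(** In the normal form [G *m pid_mx r *m H] with [r < n], the inverse of [H] maps a basis vector
    killed by [pid_mx r] to a nonzero kernel vector. *)
Lemma injective_invertible_mx n (X : 'M[D]_n) :
  (forall h : 'cV_n, X *m h = 0 -> h = 0) -> invertible_mx X.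
Proof.
move=> injX; have [G [H [r [iG [H' [HH' H'H]] XE]]]] := rank_normal_form X.
have [nr|rn] := leqP n r.
  rewrite XE -pid_mx_minv (minn_idPl nr) pid_mx_1 mulmx1.
  by apply: invertible_mxM => //; exists H'.
pose d : 'cV[D]_n := delta_mx (Ordinal rn) 0.
have : H' *m d = 0.
  apply: injX; rewrite XE -mulmxA (mulmxA H) HH' mul1mx -mulmxA.
  suff -> : (pid_mx r : 'M[D]_n) *m d = 0 by rewrite mulmx0.
  apply/colP => i; rewrite !mxE big1 // => j _; rewrite !mxE.
  have [->|] := eqVneq j (Ordinal rn); last by rewrite mulr0.
  by case: eqVneq => /= [->|_]; rewrite ?ltnn mul0r.
move/(congr1 (mulmx H)); rewrite mulmxA HH' mul1mx mulmx0.
by move/colP/(_ (Ordinal rn))/eqP; rewrite !mxE !eqxx oner_eq0.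
Qed.
End Pencils.

(** * Pairs of 3 x 3 matrices over a division ring of characteristic zero *)

Section ThreeByThree.
Variable D : unitRingType.
Hypothesis divD : forall x : D, x != 0 -> x \is a GRing.unit.
Hypothesis charD : forall n, n.+1%:R != 0 :> D.

Definition col3 (x y z : D) : 'cV_3 := \col_i nth 0 [:: x; y; z] i.
Definition row3 (x y z : D) : 'rV_3 := \row_i nth 0 [:: x; y; z] i.
Definition mx3 (s : seq (seq D)) : 'M_3 := \matrix_(i, j) nth 0 (nth [::] s i) j.

Lemma mx3_eta (Y : 'M[D]_3) :
  exists a b c d e f g h k, Y = mx3 [:: [:: a; b; c]; [:: d; e; f]; [:: g; h; k]].
Proof.
pose y i j := Y (inord i) (inord j).
exists (y 0 0)%N, (y 0 1)%N, (y 0 2)%N, (y 1 0)%N, (y 1 1)%N, (y 1 2)%N,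
  (y 2 0)%N, (y 2 1)%N, (y 2 2)%N.
by apply/matrixP => -[[|[|[|//]]] i] [[|[|[|//]]] j]; rewrite mxE /= /y;
  congr (Y _ _); apply: val_inj; rewrite /= inordK.
Qed.

Lemma pencil_rank_le_id_corner (Y : 'M[D]_3) :
  Y ord_max ord0 != 0 -> pencil_rank_le 1%:M Y 4.
Proof.
have [y00 [y01 [y02 [y10 [y11 [y12 [y20 [y21 [y22 ->]]]]]]]]] := mx3_eta Y.
rewrite mxE /= => /divD u20.
(* The rank one matrix will be [col3 p k 1 *m row3 y20 y21 q]: [k] fits the entry [y10], while [p]
   and [q] leave [l + 1] and [l - 1] at the ends of the diagonal. *)
have [k kE] : exists k, y10 = k * y20 by exists (y10 / y20); rewrite divrK.
pose l := y11 - k * y21.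
have [p pE] : exists p, y00 = l + 1 + p * y20.
  by exists ((y00 - l - 1) / y20); rewrite divrK //; nc_ring.
pose q := y22 - l + 1.
pose z01 := y01 - p * y21; pose z02 := y02 - p * q; pose z12 := y12 - k * q.
(* Once [l] times the identity is removed, the eigenvalues 1, 0, -1 are central, so the eigenvectors
   solve linear equations even if [l] is not central. The gap 2 between 1 and -1 causes the
   halving. *)
have [g gg] : exists g, g + g = z01 * z12 - z02.
  exists (2%:R^-1 * (z01 * z12 - z02)).
  by rewrite -mulr2n -[LHS]mulr_natl mulrA mulrV ?mul1r ?divD ?charD.
have gE : y02 = z01 * z12 - (g + g) + p * q by rewrite gg /z02; nc_ring.
(* After the last term is removed, Y is upper triangular with diagonal entries
   l + 1, l, l - 1; the first three terms come from its left eigenvectors. *)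
exists [:: (1, l + 1, col3 1 0 0, row3 1 z01 (z01 * z12 - g));
           (1, l, col3 (- z01) 1 0, row3 0 1 z12);
           (1, l - 1, col3 g (- z12) 1, row3 0 0 1);
           (0, 1, col3 p k 1, row3 y20 y21 q)].
rewrite !big_cons !big_nil /=; split=> //; apply/matrixP;
  move=> -[[|[|[|//]]] i] [[|[|[|//]]] j]; rewrite !mxE !big_ord1 !mxE /=.
all: rewrite ?mulr1n ?mulr0n.
all: rewrite ?gE ?kE ?pE /z12 /z01 /q /l.
all: nc_ring.
Qed.

Lemma pencil_rank_le_id (Y : 'M[D]_3) : pencil_rank_le 1%:M Y 4.
Proof.
case: (pickP (fun u : 'I_3 * 'I_3 => (u.1 != u.2) && (Y u.1 u.2 != 0))).
  move=> [i j] /= /andP [ij Yij].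
  (* As [i != j], some permutation sends [ord0] to [j] and [ord_max] to [i]; it brings [Y i j] to
     the lower left corner. *)
  pose s := (tperm ord_max (tperm ord0 j i) * tperm ord0 j)%g.
  have s0 : s ord0 = j.
    rewrite permM [X in tperm ord0 j X]tpermD ?tpermL //.
    by apply: contra_neq ij => /(canRL (tpermK _ _)); rewrite tpermL.
  have sm : s ord_max = i by rewrite permM tpermL tpermK.
  apply: (@pencil_rank_le_perm _ _ s).
  have -> : row_perm s (col_perm s 1%:M) = 1%:M :> 'M[D]_3.
    by apply/matrixP => u v; rewrite !mxE (inj_eq perm_inj).
  by apply: pencil_rank_le_id_corner; rewrite !mxE s0 sm.
move=> offdiag; apply: (@pencil_rank_leW _ _ _ _ _ 3) => //.
exists [seq (1, Y i i, delta_mx i 0, delta_mx 0 i) | i <- enum 'I_3].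
rewrite size_map size_enum_ord !big_map -enumT !big_enum /=; split=> //.
  apply/matrixP => i j; rewrite summxE (bigD1 i) //= big1 => [|u /negPf ui].
    by rewrite mul_delta_mx !mxE eqxx addr0 mul1r eq_sym.
  by rewrite mul_delta_mx !mxE eq_sym ui mulr0.
apply/matrixP => i j; rewrite summxE (bigD1 i) //= big1 => [|u /negPf ui].
  rewrite mul_delta_mx !mxE eqxx addr0 /=.
  have [->|ij] := eqVneq j i; first by rewrite mulr1.
  have /= := offdiag (i, j); rewrite eq_sym ij /= => /negbFE/eqP ->.
  by rewrite mulr0.
by rewrite mul_delta_mx !mxE eq_sym ui mulr0.
Qed.

Lemma pencil_rank_le_invertible (X Y : 'M[D]_3) z :
  invertible_mx (X + z *: Y) -> pencil_rank_le X Y 4.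
Proof.
move=> [G [XG GX]]; apply: (@pencil_rank_le_shift _ _ _ _ _ z).
have := pencil_rank_le_mulmxr (X + z *: Y) (pencil_rank_le_id (Y *m G)).
by rewrite mul1mx -mulmxA GX mulmx1.
Qed.

(** These scalars are central and invertible, and three of them are enough to escape the roots of a
    quadratic polynomial. *)
Definition small z : Prop := [\/ z = 1, z = 1 + 1 | z = 1 + 1 + 1 :> D].

Lemma small_unit z : small z -> z \is a GRing.unit.
Proof.
case=> ->; first exact: unitr1.
  exact: divD (charD 1).
by have := divD (charD 2); rewrite mulrSr mulr2n.
Qed.

Lemma small_central z x : small z -> z * x = x * z.
Proof. by case=> ->; nc_ring. Qed.

Lemma mulf0_eq (x h : D) : x != 0 -> x * h = 0 -> h = 0.
Proof. by move=> /divD ux xh; apply: (mulrI ux); rewrite mulr0. Qed.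

(** The third finite difference of a quadratic [P] vanishes, so
    [u = P 0 = 3 P(1) - 3 P(2) + P(3)]. *)
Lemma small_quadratic_neq0 (u v w : D) :
  u != 0 -> exists2 z, small z & u + z * v + z * z * w != 0.
Proof.
pose P z := u + z * v + z * z * w => u0.
have [P1|] := eqVneq (P 1) 0; last by exists 1 => //; constructor.
have [P2|] := eqVneq (P (1 + 1)) 0; last by exists (1 + 1) => //; constructor.
exists (1 + 1 + 1); first by constructor.
apply: contra_neq u0 => P3.
have -> : u = (P 1 - P (1 + 1)) * (1 + 1 + 1) + P (1 + 1 + 1) by rewrite /P; nc_ring.
by rewrite P1 P2 [P _]P3 subrr mul0r addr0.
Qed.

(** In place of a determinant, a quadratic in [z] that annihilates [h1]. For [b = 0] it is
    [(1 + z d)(1 + z a)]; otherwise the first equation expresses [z h2] by [h1], and substitution in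
    the second gives a quadratic with constant term [- b^-1]. *)
Lemma small_pencil2_injective (a b c d : D) :
  exists2 z, small z & forall h1 h2,
    h1 + z * (a * h1 + b * h2) = 0 -> h2 + z * (c * h1 + d * h2) = 0 ->
    h1 = 0 /\ h2 = 0.
Proof.
have [b0|b0] := eqVneq b 0.
  have [z sz Pz] := small_quadratic_neq0 (a + d) (d * a) (oner_neq0 D).
  have PE : 1 + z * (a + d) + z * z * (d * a) = (1 + z * d) * (1 + z * a).
    by case: sz => ->; nc_ring.
  exists z => // h1 h2 E1 E2.
  have h10 : h1 = 0.
    apply: (mulf0_eq Pz); rewrite PE -[RHS](mulr0 (1 + z * d)) -E1 b0; nc_ring.
  split=> //; have : (1 + z * d) * h2 = 0 by rewrite -E2 h10; nc_ring.
  by apply: mulf0_eq; apply: contra_neq Pz => dz; rewrite PE dz mul0r.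
have ub := divD b0; have bV0 : - b^-1 != 0 by rewrite oppr_eq0 invr_eq0.
have [z sz Pz] :=
  small_quadratic_neq0 (- (d * b^-1 + b^-1 * a)) (c - d * b^-1 * a) bV0.
exists z => // h1 h2 E1 E2.
have zh2 : z * h2 = - b^-1 * (1 + z * a) * h1.
  apply: (mulrI ub); apply/eqP; rewrite -subr_eq0; apply/eqP; rewrite -E1.
  rewrite !mulrA mulrN divrr //; case: sz => ->; nc_ring.
have h10 : h1 = 0.
  apply: (mulf0_eq Pz); have <- : z * (h2 + z * (c * h1 + d * h2)) = 0.
    by rewrite E2 mulr0.
  have -> : z * (h2 + z * (c * h1 + d * h2)) =
    z * h2 + z * z * c * h1 + z * d * (z * h2) by case: sz => ->; nc_ring.
  by rewrite zh2; case: sz => ->; nc_ring.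
split=> //; apply: (mulrI (small_unit sz)).
by rewrite zh2 h10 !mulr0.
Qed.

(** * Pairs whose first matrix has rank two *)

Definition free3 (b1 b2 b3 : 'cV[D]_3) :=
  forall s1 s2 s3 : 'M[D]_1,
    b1 *m s1 + b2 *m s2 + b3 *m s3 = 0 -> [/\ s1 = 0, s2 = 0 & s3 = 0].

(** Independence of the rows in dual form: the coordinates [e1 h], [e2 h], [e3 h] determine [h]. *)
Definition cofree3 (e1 e2 e3 : 'rV[D]_3) :=
  forall h : 'cV[D]_3, e1 *m h = 0 -> e2 *m h = 0 -> e3 *m h = 0 -> h = 0.

(** The three equations say that [X + z Y] kills the vector with coordinates [h1, h2, h3], the third
    one divided by [z]. Hence [X + z Y] is injective, so invertible. Centrality of [z] lets it pass
    the columns [b1, b2, b3]. *)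
Lemma pencil_rank_le_scalar (b1 b2 b3 : 'cV[D]_3) (e1 e2 e3 : 'rV[D]_3)
    (a b p c d q e f y z : D) :
  free3 b1 b2 b3 -> cofree3 e1 e2 e3 -> small z ->
  (forall h1 h2 h3,
     h1 + z * (a * h1 + b * h2 + p * h3) = 0 ->
     h2 + z * (c * h1 + d * h2 + q * h3) = 0 ->
     e * h1 + f * h2 + y * h3 = 0 -> [/\ h1 = 0, h2 = 0 & h3 = 0]) ->
  pencil_rank_le (b1 *m e1 + b2 *m e2)
    (b1 *m (a *: e1 + b *: e2 + p *: e3) + b2 *m (c *: e1 + d *: e2 + q *: e3)
     + b3 *m (e *: e1 + f *: e2 + y *: e3)) 4.
Proof.
move=> fb fe sz inj; apply: (pencil_rank_le_invertible (z := z)).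
apply: (injective_invertible_mx divD) => h.
have zC m n (B : 'M[D]_(3, m)) (A : 'M_(m, n)) : z *: (B *m A) = B *m (z *: A).
  apply/matrixP => i j; rewrite !mxE mulr_sumr; apply: eq_bigr => k _.
  by rewrite !mxE !mulrA (small_central _ sz).
have actE (r1 r2 r3 : 'rV[D]_3) :
  (b1 *m e1 + b2 *m e2 + z *: (b1 *m r1 + b2 *m r2 + b3 *m r3)) *m h =
  b1 *m (e1 *m h + z *: (r1 *m h)) + b2 *m (e2 *m h + z *: (r2 *m h))
  + b3 *m (z *: (r3 *m h)).
  rewrite !scalerDr !zC !mulmxDl !mulmxDr -!mulmxA -!scalemxAl.
  by rewrite !addrA; congr (_ + _ + _); rewrite addrAC.
rewrite actE.
pose s (u : 'rV_3) := (u *m h) 0 0.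
have rE (x1 x2 x3 : D) :
  ((x1 *: e1 + x2 *: e2 + x3 *: e3) *m h) 0 0 = x1 * s e1 + x2 * s e2 + x3 * s e3.
  by rewrite !mulmxDl -!scalemxAl !mxE -/(s _) [s e1]mxE [s e2]mxE [s e3]mxE.
move=> /fb [/matrixP/(_ 0 0) E1 /matrixP/(_ 0 0) E2 /matrixP/(_ 0 0) E3].
rewrite mxE [X in _ + X]mxE rE [RHS]mxE in E1.
rewrite mxE [X in _ + X]mxE rE [RHS]mxE in E2.
rewrite mxE rE [RHS]mxE in E3.
have E3' : e * s e1 + f * s e2 + y * s e3 = 0.
  by apply: (mulrI (small_unit sz)); rewrite mulr0.
have [h1 h2 h3] := inj _ _ _ E1 E2 E3'.
have s0 (u : 'rV_3) : s u = 0 -> u *m h = 0.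
  by move=> su; apply/matrixP => i j; rewrite !ord1 -[LHS]/(s u) su mxE.
by apply: fe; apply: s0.
Qed.

Lemma pencil_rank_le_rank2_corner (b1 b2 b3 : 'cV[D]_3) (e1 e2 e3 : 'rV[D]_3)
    (a b p c d q e f : D) :
  free3 b1 b2 b3 -> cofree3 e1 e2 e3 -> p != 0 ->
  pencil_rank_le (b1 *m e1 + b2 *m e2)
    (b1 *m (a *: e1 + b *: e2 + p *: e3) + b2 *m (c *: e1 + d *: e2 + q *: e3)
     + b3 *m (e *: e1 + f *: e2)) 4.
Proof.
move=> fb fe p0.
have [k kE] : exists k, q = k * p by exists (q / p); rewrite divrK ?divD.
(* Subtracting [k] times the first kernel equation from the second eliminates [h3]; in the unknowns
   [h1] and [g = h2 - k h1] the remaining coefficients are [c1, d1] and [e', f]. Afterwards [p != 0]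
   forces [h3 = 0]. *)
pose d1 := d - k * b; pose c1 := c - k * a + d1 * k; pose e' := e + f * k.
have scalar z : small z -> (forall h1 g, g + z * (c1 * h1 + d1 * g) = 0 ->
    e' * h1 + f * g = 0 -> h1 = 0 /\ g = 0) -> pencil_rank_le (b1 *m e1 + b2 *m e2)
    (b1 *m (a *: e1 + b *: e2 + p *: e3) + b2 *m (c *: e1 + d *: e2 + q *: e3)
     + b3 *m (e *: e1 + f *: e2)) 4.
  move=> sz inj; rewrite -[X in b3 *m X]addr0 -(scale0r e3).
  apply: (pencil_rank_le_scalar fb fe sz) => h1 h2 h3 E1 E2 E3.
  have [h10 g0] : h1 = 0 /\ h2 - k * h1 = 0.
    apply: inj.
      rewrite -[RHS](subrr 0) -{1}E2 -[in X in _ = _ - X](mulr0 k) -E1.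
      by rewrite /c1 /d1 kE; case: sz => ->; nc_ring.
    by rewrite -E3 /e'; nc_ring.
  have h20 : h2 = 0 by move: g0; rewrite h10 mulr0 subr0.
  split=> //; apply: (mulf0_eq p0); apply: (mulrI (small_unit sz)).
  by rewrite mulr0 -E1 h10 h20; nc_ring.
(* If [e' != 0], then [h1] is a left multiple of [g], and [g] is annihilated by a polynomial in [z]
   with constant term 1. *)
have [e0|e0] := eqVneq e' 0; last first.
  have [z sz Pz] :=
    small_quadratic_neq0 (d1 - c1 * e'^-1 * f) 0 (oner_neq0 D).
  apply: (scalar z sz) => h1 g E1 E2.
  have h1E : h1 = - (e'^-1 * f * g).
    apply: (mulrI (divD e0)); rewrite mulrN !mulrA divrr ?divD // mul1r.
    by apply/eqP; rewrite -addr_eq0 E2.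
  have g0 : g = 0.
    by apply: (mulf0_eq Pz); rewrite -[RHS]E1 h1E; nc_ring.
  by rewrite h1E g0 mulr0 oppr0.
(* If [e' = f = 0], both images lie in the plane spanned by [b1] and [b2]. *)
have [f0|f0] := eqVneq f 0.
  have -> : e = 0 by rewrite -e0 /e' f0 mul0r addr0.
  rewrite f0 !scale0r addr0 mulmx0 addr0.
  by apply: (@pencil_rank_leD _ _ _ _ _ _ _ 2 2); apply: pencil_rank_le_row.
(* Now [f g = 0] gives [g = 0], and the other equation becomes [z c1 h1 = 0]. *)
have [c0|c0] := eqVneq c1 0; last first.
  apply: (scalar 1); first by constructor.
  move=> h1 g E1 E2.
  have g0 : g = 0 by apply: (mulf0_eq f0); rewrite -[RHS]E2 e0 mul0r add0r.
  split=> //; apply: (mulf0_eq c0); rewrite -[RHS]E1 g0; nc_ring.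
(* With [c1 = e' = 0], both matrices map the plane [u h = 0], which is [g = 0], into the line of
   [v]: each is [v] times a row plus a column times [u]. *)
pose u := e2 - k *: e1; pose v := b1 + b2 *m k%:M.
have -> : b1 *m e1 + b2 *m e2 = v *m e1 + b2 *m u.
  rewrite /u /v mulmxDl mulmxBr -mulmxA mul_scalar_mx -addrA.
  by rewrite [_ + (_ - _)]addrC subrK.
have -> : b1 *m (a *: e1 + b *: e2 + p *: e3) + b2 *m (c *: e1 + d *: e2 + q *: e3)
     + b3 *m (e *: e1 + f *: e2) =
  v *m (a *: e1 + b *: e2 + p *: e3) + (b2 *m d1%:M + b3 *m f%:M) *m u.
  rewrite /v !mulmxDl -!mulmxA !mul_scalar_mx -!addrA; congr (_ + _).
  rewrite !addrA -mulmxDr; congr (b2 *m _ + b3 *m _).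
    apply/rowP => j; rewrite !mxE kE.
    have -> : c = k * a - d1 * k by rewrite -[RHS]addr0 -c0 /c1; nc_ring.
    by rewrite /d1; nc_ring.
  apply/rowP => j; rewrite !mxE.
  have -> : e = - (f * k) by apply/eqP; rewrite -addr_eq0 -e0.
  by nc_ring.
apply: (@pencil_rank_leD _ _ _ _ _ _ _ 2 2); first exact: pencil_rank_le_row.
exact: pencil_rank_le_col.
Qed.

Lemma pencil_rank_le_rank2 (b1 b2 b3 : 'cV[D]_3) (e1 e2 e3 : 'rV[D]_3)
    (a b p c d q e f y : D) :
  free3 b1 b2 b3 -> cofree3 e1 e2 e3 ->
  pencil_rank_le (b1 *m e1 + b2 *m e2)
    (b1 *m (a *: e1 + b *: e2 + p *: e3) + b2 *m (c *: e1 + d *: e2 + q *: e3)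
     + b3 *m (e *: e1 + f *: e2 + y *: e3)) 4.
Proof.
(* If [y != 0], the third equation yields [h3], and the Schur complement of [y] gives a 2 x 2 system
   of the form already treated. *)
move=> fb fe; have [->|y0] := eqVneq y 0; last first.
  pose w := y^-1.
  have [z sz inj] := small_pencil2_injective (a - p * w * e) (b - p * w * f)
    (c - q * w * e) (d - q * w * f).
  apply: (pencil_rank_le_scalar fb fe sz) => h1 h2 h3 E1 E2 E3.
  have h3E : h3 = - (w * (e * h1 + f * h2)).
    apply: (mulrI (divD y0)); rewrite mulrN !mulrA divrr ?divD // mul1r.
    by apply/eqP; rewrite -addr_eq0 addrC E3.
  have [h10 h20] : h1 = 0 /\ h2 = 0.
    apply: inj; [rewrite -[RHS]E1|rewrite -[RHS]E2]; rewrite h3E; nc_ring.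
  by rewrite h3E h10 h20 !mulr0 addr0 mulr0 oppr0.
rewrite scale0r addr0.
have [->|p0] := eqVneq p 0; last exact: (pencil_rank_le_rank2_corner _ _ _ _ _ _ _ fb).
(* The case [q != 0] is the case [p != 0] with indices 1 and 2 exchanged in both bases. If
   [p = q = y = 0], both matrices kill the common kernel of [e1] and [e2]. *)
have [->|q0] := eqVneq q 0; last first.
  rewrite [b1 *m e1 + _]addrC [b1 *m (_ + _) + _]addrC.
  rewrite [c *: e1 + _]addrC [a *: e1 + _]addrC [e *: e1 + _]addrC.
  apply: (@pencil_rank_le_rank2_corner b2 b1 b3 e2 e1 e3) => //.
    by move=> s1 s2 s3; rewrite [X in X + _]addrC => /fb [].
  by move=> h h2 h1; apply: fe.
have -> : b1 *m (a *: e1 + b *: e2 + 0 *: e3) + b2 *m (c *: e1 + d *: e2 + 0 *: e3)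
    + b3 *m (e *: e1 + f *: e2) =
  (b1 *m a%:M + b2 *m c%:M + b3 *m e%:M) *m e1 +
  (b1 *m b%:M + b2 *m d%:M + b3 *m f%:M) *m e2.
  rewrite !scale0r !addr0 !mulmxDr !mulmxDl -!mulmxA !mul_scalar_mx.
  by rewrite (addrACA (b1 *m _)) [LHS]addrACA.
by apply: (@pencil_rank_leD _ _ _ _ _ _ _ 2 2); apply: pencil_rank_le_col.
Qed.

(** * Coordinates in two bases and the case split on ranks *)

Lemma mulmx_sum3 m n (A : 'M[D]_(m, 3)) (B : 'M_(3, n)) :
  A *m B = col (inord 0) A *m row (inord 0) B + col (inord 1) A *m row (inord 1) B
    + col (inord 2) A *m row (inord 2) B.
Proof.
have [E0 E1 E2] : [/\ inord 0 = ord0 :> 'I_3, inord 1 = lift ord0 ord0 :> 'I_3 &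
    inord 2 = lift ord0 (lift ord0 ord0) :> 'I_3].
  by split; apply: val_inj; rewrite /= inordK.
apply/matrixP => i j; rewrite !mxE !big_ord_recl !big_ord0 !mxE E0 E1 E2.
by rewrite !addr0 !addrA.
Qed.

Lemma row_mul_sum3 m n (A : 'M[D]_(m, 3)) (B : 'M_(3, n)) i :
  row i (A *m B) = A i (inord 0) *: row (inord 0) B + A i (inord 1) *: row (inord 1) B
    + A i (inord 2) *: row (inord 2) B.
Proof.
rewrite row_mul mulmx_sum3.
have colE j : col j (row i A) = (A i j)%:M.
  by apply/matrixP => u v; rewrite !ord1 !mxE.
by rewrite !colE !mul_scalar_mx.
Qed.

Lemma free3_col (G : 'M[D]_3) :
  invertible_mx G -> free3 (col (inord 0) G) (col (inord 1) G) (col (inord 2) G).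
Proof.
move=> [G' [_ G'G]] s1 s2 s3; pose h := col3 (s1 0 0) (s2 0 0) (s3 0 0).
have [E1 E2 E3] :
    [/\ s1 = row (inord 0) h, s2 = row (inord 1) h & s3 = row (inord 2) h].
  by split; apply/matrixP => u v; rewrite !ord1 !mxE inordK.
rewrite E1 E2 E3 -mulmx_sum3 => /(congr1 (mulmx G')).
by rewrite mulmxA G'G mul1mx mulmx0 => ->; rewrite !row0.
Qed.

Lemma cofree3_row (H : 'M[D]_3) :
  invertible_mx H -> cofree3 (row (inord 0) H) (row (inord 1) H) (row (inord 2) H).
Proof.
move=> [H' [_ H'H]] h; rewrite -!row_mul => E0 E1 E2.
rewrite -[h]mul1mx -H'H -mulmxA; suff -> : H *m h = 0 by rewrite mulmx0.
apply/row_matrixP => i; rewrite row0 -(inord_val i).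
by case: i => -[|[|[|//]]].
Qed.

(** The matrix [G] cannot simply be cancelled on the left, so its columns and the rows of [H] serve
    as bases; the coefficients of [Y] are the entries of [G^-1 Y H^-1]. *)
Lemma pencil_rank_le_pid2 (G H Y : 'M[D]_3) :
  invertible_mx G -> invertible_mx H -> pencil_rank_le (G *m pid_mx 2 *m H) Y 4.
Proof.
move=> iG iH; have [G' [GG' _]] := iG; have [H' [_ H'H]] := iH.
have -> : Y = G *m (G' *m Y *m H' *m H).
  by rewrite -!mulmxA H'H mulmx1 mulmxA GG' mul1mx.
rewrite -mulmxA !(mulmx_sum3 G) !row_mul_sum3 !mxE !inordK //=.
rewrite !scale1r !scale0r !addr0 add0r mulmx0 addr0.
by apply: pencil_rank_le_rank2; [exact: free3_col|exact: cofree3_row].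
Qed.

Lemma rank3_cases (X : 'M[D]_3) :
  [\/ invertible_mx X,
      exists G H, [/\ invertible_mx G, invertible_mx H & X = G *m pid_mx 2 *m H]
    | exists (b : 'cV_3) (c : 'rV_3), X = b *m c].
Proof.
have [G [H [[|[|[|r]]] [iG iH ->]]]] := rank_normal_form divD X.
- by constructor 3; exists 0, 0; rewrite pid_mx_0 mulmx0 !mul0mx.
- constructor 3; exists (G *m delta_mx ord0 0), (delta_mx 0 ord0 *m H).
  rewrite mulmxA -[in RHS](mulmxA G) mul_delta_mx; congr (_ *m _ *m _).
  by apply/matrixP => -[[|i] ?] [[|j] ?]; rewrite !mxE // andbF.
- by constructor 2; exists G, H.
constructor 1; rewrite -pid_mx_minv (minn_idPl _) // pid_mx_1 mulmx1.
exact: invertible_mxM.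
Qed.

Lemma pencil3_rank_le4 (X Y : 'M[D]_3) : pencil_rank_le X Y 4.
Proof.
have inv (A B : 'M[D]_3) : invertible_mx A -> pencil_rank_le A B 4.
  by move=> iA; apply: (pencil_rank_le_invertible (z := 0)); rewrite scale0r addr0.
have [|[G [H [iG iH ->]]]|[b [c XE]]] := rank3_cases X; first exact: inv.
  exact: pencil_rank_le_pid2.
have [|[G [H [iG iH ->]]]|[b' [c' YE]]] := rank3_cases Y.
- by move=> iY; apply/pencil_rank_leC/inv.
- exact/pencil_rank_leC/pencil_rank_le_pid2.
apply: (@pencil_rank_leW _ _ _ _ _ 2) => //.
have := pencil_rank_leD (pencil_rank_le_term 1 0 b c) (pencil_rank_le_term 0 1 b' c').
by rewrite !scale1r !scale0r addr0 add0r -XE -YE.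
Qed.
End ThreeByThree.

(** * The quaternions as a division ring with conjugation *)

Section QuaternionRing.
Variable R : realType.
Implicit Types x y z : quat R.

Definition quat_tuple x := (q0 x, q1 x, q2 x, q3 x).
Definition tuple_quat (u : R * R * R * R) := Quat u.1.1.1 u.1.1.2 u.1.2 u.2.
Lemma quat_tupleK : cancel quat_tuple tuple_quat. Proof. by case. Qed.

HB.instance Definition _ := Choice.copy (quat R) (can_type quat_tupleK).

Lemma quatP x y :
  q0 x = q0 y -> q1 x = q1 y -> q2 x = q2 y -> q3 x = q3 y -> x = y.
Proof. by case: x y => [????] [????] /= -> -> -> ->. Qed.

Definition qopp x := Quat (- q0 x) (- q1 x) (- q2 x) (- q3 x).
Definition qone : quat R := Quat 1 0 0 0.
Definition qconj x := Quat (q0 x) (- q1 x) (- q2 x) (- q3 x).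
Definition qnormsq x := q0 x ^+ 2 + q1 x ^+ 2 + q2 x ^+ 2 + q3 x ^+ 2.

Fact qaddA : associative (@qadd R).
Proof. by move=> x y z; apply: quatP => /=; ring. Qed.
Fact qaddC : commutative (@qadd R).
Proof. by move=> x y; apply: quatP => /=; ring. Qed.
Fact qadd0 : left_id (qzero R) (@qadd R).
Proof. by move=> x; apply: quatP => /=; ring. Qed.
Fact qaddN : left_inverse (qzero R) qopp (@qadd R).
Proof. by move=> x; apply: quatP => /=; ring. Qed.
HB.instance Definition _ := GRing.isZmodule.Build (quat R) qaddA qaddC qadd0 qaddN.

Fact qmulA : associative (@qmul R).
Proof. by move=> x y z; apply: quatP => /=; ring. Qed.
Fact qmul1 : left_id qone (@qmul R).
Proof. by move=> x; apply: quatP => /=; ring. Qed.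
Fact qmulr1 : right_id qone (@qmul R).
Proof. by move=> x; apply: quatP => /=; ring. Qed.
Fact qmulDl : left_distributive (@qmul R) (@qadd R).
Proof. by move=> x y z; apply: quatP => /=; ring. Qed.
Fact qmulDr : right_distributive (@qmul R) (@qadd R).
Proof. by move=> x y z; apply: quatP => /=; ring. Qed.
Fact qone_neq0 : qone != qzero R.
Proof. by apply/eqP => -[] /eqP; rewrite oner_eq0. Qed.
HB.instance Definition _ := GRing.Zmodule_isNzRing.Build (quat R)
  qmulA qmul1 qmulr1 qmulDl qmulDr qone_neq0.

Lemma qnormsq_eq0 x : (qnormsq x == 0) = (x == 0).
Proof.
apply/eqP/eqP => [|->]; last by rewrite /qnormsq /= expr0n /= !addr0.
have sq (r : R) : 0 <= r ^+ 2 by rewrite sqr_ge0.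
rewrite /qnormsq => n0.
have := (sq (q0 x), sq (q1 x), sq (q2 x), sq (q3 x)); move=> [[[s0 s1] s2] s3].
have z (r : R) : r ^+ 2 = 0 -> r = 0 by move=> /eqP; rewrite sqrf_eq0 => /eqP.
by apply: quatP; apply: z; lra.
Qed.

(* The convention x^-1 = x outside units holds at 0 because 0 / 0 = 0 in R. *)
Definition qinv x := Quat (q0 x / qnormsq x) (- q1 x / qnormsq x)
                          (- q2 x / qnormsq x) (- q3 x / qnormsq x).

Fact qmulV : {in [pred x : quat R | x != 0], left_inverse 1 qinv *%R}.
Proof.
move=> x; rewrite inE -qnormsq_eq0 => nx.
by apply: quatP; rewrite /= /qnormsq; field.
Qed.
Fact qmulrV : {in [pred x : quat R | x != 0], right_inverse 1 qinv *%R}.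
Proof.
move=> x; rewrite inE -qnormsq_eq0 => nx.
by apply: quatP; rewrite /= /qnormsq; field.
Qed.
Fact qunitP x y : y * x = 1 /\ x * y = 1 -> [pred x : quat R | x != 0] x.
Proof.
by move=> [yx _] /=; apply: contra_eq_neq yx => ->; rewrite mulr0 eq_sym oner_eq0.
Qed.
Fact qinv_out : {in [predC [pred x : quat R | x != 0]], qinv =1 id}.
Proof.
move=> x; rewrite !inE negbK => /eqP ->.
by apply: quatP; rewrite /= ?oppr0 mul0r.
Qed.
HB.instance Definition _ := GRing.NzRing_hasMulInverse.Build (quat R)
  qmulV qmulrV qunitP qinv_out.

Lemma quat_unit x : x != 0 -> x \is a GRing.unit.
Proof. by []. Qed.

Lemma quat_natr_neq0 n : n.+1%:R != 0 :> quat R.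
Proof.
have q0n m : q0 (m%:R : quat R) = m%:R.
  by elim: m => [|m IH]; rewrite ?mulr0n // !mulrS /= IH.
by apply/eqP => /(congr1 (@q0 R)); rewrite q0n => /eqP; rewrite pnatr_eq0.
Qed.

Lemma qconjM x y : qconj (x * y) = qconj y * qconj x.
Proof. by apply: quatP => /=; ring. Qed.
Lemma qconjD x y : qconj (x + y) = qconj x + qconj y.
Proof. by apply: quatP => /=; ring. Qed.
Lemma qconjK : involutive qconj.
Proof. by move=> x; apply: quatP => /=; ring. Qed.
End QuaternionRing.

(** * From pairs of matrices back to tensors *)

Section Tensors.
Variable R : realType.

(** Simple tensors are nonzero by definition, so the vanishing terms are filtered out, which only
    shortens the sum. *)
Lemma rank_le_sum n1 n2 n3 (T : qtensor R n1 n2 n3) r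
    (s : seq (('I_n1 -> quat R) * ('I_n2 -> quat R) * ('I_n3 -> quat R))) :
  (size s <= r)%N ->
  (forall i j k, T i j k = \sum_(u <- s) u.1.1 i * u.1.2 j * u.2 k) ->
  rank_le T r.
Proof.
move=> sr TE.
pose nz (u : ('I_n1 -> quat R) * ('I_n2 -> quat R) * ('I_n3 -> quat R)) :=
  [exists i, exists j, exists k, u.1.1 i * u.1.2 j * u.2 k != 0].
pose s' := filter nz s.
exists (size s'); split; first by rewrite (leq_trans _ sr) // size_filter count_size.
exists (fun l i j k => let u := tnth (in_tuple s') l in u.1.1 i * u.1.2 j * u.2 k).
split=> [l|i j k].
  split; last by exists (tnth (in_tuple s') l).1.1, (tnth (in_tuple s') l).1.2,
                        (tnth (in_tuple s') l).2.
  have /(all_nthP (tnth (in_tuple s') l)) := filter_all nz s.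
  move=> /(_ l (ltn_ord l)) /existsP [i /existsP [j /existsP [k /eqP ijk]]].
  by exists i, j, k; rewrite (tnth_nth (tnth (in_tuple s') l)).
rewrite TE; transitivity (\sum_(u <- s') u.1.1 i * u.1.2 j * u.2 k).
  rewrite big_filter [RHS]big_mkcond /=; apply: eq_bigr => u _.
  case: ifPn => //; rewrite negb_exists => /forallP/(_ i).
  rewrite negb_exists => /forallP/(_ j); rewrite negb_exists => /forallP/(_ k).
  by rewrite negbK => /eqP.
by rewrite big_tnth.
Qed.

(** The pair of matrices comes from fixing the first index [i], not from the frontal slices; the two
    coefficients of a term form the vector [a]. *)
Lemma tensor233_sum (T : qtensor R 2 3 3) :
  exists2 s : seq (('I_2 -> quat R) * ('I_3 -> quat R) * ('I_3 -> quat R)),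
    (size s <= 4)%N &
    forall i j k, T i j k = \sum_(u <- s) u.1.1 i * u.1.2 j * u.2 k.
Proof.
pose X i : 'M[quat R]_3 := \matrix_(j, k) T i j k.
have [s [s4 X0 X1]] :=
  pencil3_rank_le4 (@quat_unit R) (@quat_natr_neq0 R) (X ord0) (X ord_max).
pose term (u : quat R * quat R * 'cV[quat R]_3 * 'rV[quat R]_3) :=
  (fun i : 'I_2 => if i == ord0 then u.1.1.1 else u.1.1.2,
   fun j => u.1.2 j 0, fun k => u.2 0 k).
exists [seq term u | u <- s]; first by rewrite size_map.
move=> i j k; rewrite big_map /=; case: (eqVneq i ord0) => [->|i0].
  have /matrixP/(_ j k) := X0; rewrite mxE summxE => ->.
  by apply: eq_bigr => u _; rewrite !mxE big_ord1 mulrA.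
have -> : i = ord_max by case: i i0 => -[|[|//]] // *; apply: val_inj.
have /matrixP/(_ j k) := X1; rewrite mxE summxE => ->.
by apply: eq_bigr => u _; rewrite !mxE big_ord1 mulrA.
Qed.
End Tensors.

Theorem mainTheorem11 (R : realType) :
  (forall T : qtensor R 2 3 3, rank_le T 4) /\
  (forall T : qtensor R 3 3 2, rank_le T 4).
Proof.
split=> T; first by have [s s4 TE] := tensor233_sum T; apply: rank_le_sum TE.
have [s s4 TE] := tensor233_sum (fun i j k => qconj (T k j i)).
(* Conjugation reverses products, so the outer factors trade places just as the indices [i] and [k]
   do. *)
pose conj_term (u : ('I_2 -> quat R) * ('I_3 -> quat R) * ('I_3 -> quat R)) :=
  (fun i => qconj (u.2 i), fun j => qconj (u.1.2 j), fun k => qconj (u.1.1 k)).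
apply: (@rank_le_sum _ _ _ _ _ _ [seq conj_term u | u <- s]); first by rewrite size_map.
move=> i j k; rewrite -[T i j k]qconjK TE big_map.
have qconj0 : qconj 0 = 0 :> quat R by apply: quatP; rewrite /= ?oppr0.
rewrite (big_morph _ (@qconjD R) qconj0); apply: eq_bigr => u _.
by rewrite !qconjM mulrA.
Qed.
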